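(* Let $k\ge 2$ and let $\mathrm{Cone}=\mathrm{Cone}(\mathrm{Cone}_{2k+1}\cup\mathrm{Cone}_{2k+3})$. Then $\mathrm{Cone}$ is a maximal commutative algebraic system in $\mathcal{P}_{4k+7}( * )$.
   Context: Write $[a]=\{1,\dots,a\}$, $[a,b]=\{a,\dots,b\}$, and let $\mathcal{P}_n( * )$ be the collection of all nonempty subsets of $[n]$. Let $n=4k+7$. A nonempty collection $\Delta$ of subsets of $[n]$ of odd size is an algebraic system if for every $A_1\subseteq[n]$ with $|A_1|$ even and every $A_2\in\Delta$ with $A_1\cap A_2=\emptyset$ we have $A_1\cup A_2\in\Delta$. It is commutative if any two elements of $\Delta$ have nonempty intersection. A commutative system $\Delta$ is maximal if for every $A\subseteq[n]$ with $|A|$ odd and $A\notin\Delta$ there is $B\in\Delta$ with $A\cap B=\emptyset$. A maximal commutative algebraic system is an algebraic system that is commutative and maximal. For $S\subset[n]$, $\vee^1S:=\{S\}\cup\{S\cup S_1\mid S_1\subseteq[n],\ |S_1|=2,\ S_1\cap S=\emptyset\}$; for a collection $\mathcal{B}$, $\vee^1\mathcal{B}:=\bigcup_{S\in\mathcal{B}}\vee^1S$ and $\vee^i\mathcal{B}:=\vee^1(\vee^{i-1}\mathcal{B})$ for $i>1$. $\mathrm{Cone}(\mathcal{B})$ is the collection $\bigcup_{i\ge1}\vee^i\mathcal{B}$ of subsets of $[n]$. Define the following seven triples in $[4k+1,4k+7]$: $L_1=\{4k+1,4k+2,4k+5\}$, $L_2=\{4k+1,4k+3,4k+6\}$, $L_3=\{4k+1,4k+4,4k+7\}$,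 $L_4=\{4k+2,4k+3,4k+7\}$, $L_5=\{4k+3,4k+4,4k+5\}$, $L_6=\{4k+5,4k+6,4k+7\}$, $L_7=\{4k+2,4k+4,4k+6\}$. For $1\le i\le7$, $\mathcal{B}_i=\{L_i\cup S'\mid S'\subset[4k],\ |S'|=2k\}$. Then $\mathrm{Cone}_{2k+1}:=\{S\subset[4k]\mid |S|=2k+1\}$ and $\mathrm{Cone}_{2k+3}:=\bigcup_{i=1}^7\mathcal{B}_i$. *)

(* Defs.v *)
From mathcomp Require Import all_boot.

Set Implicit Arguments.
Unset Strict Implicit.
Unset Printing Implicit Defensive.

(* The ground set [n] = {1, ..., n} is represented by 'I_n, the element x of
   'I_n standing for the integer x.+1. *)
Definition with_labels (n : nat) (s : seq nat) : {set 'I_n} :=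
  [set x : 'I_n | x.+1 \in s].

Definition initial_segment (n m : nat) : {set 'I_n} :=
  [set x : 'I_n | x.+1 <= m].

(* A collection of subsets is a Prop-valued predicate, since Cone below is a
   union over infinitely many indices; generating families are finite sets. *)
Definition collection (n : nat) := {set 'I_n} -> Prop.

Definition P_star (n : nat) : collection n := fun S => S != set0.

Definition algebraic_system (n : nat) (Delta : collection n) : Prop :=
  [/\ exists S, Delta S,
      forall S, Delta S -> odd #|S|
    & forall A1 A2 : {set 'I_n},
        ~~ odd #|A1| -> Delta A2 -> A1 :&: A2 = set0 -> Delta (A1 :|: A2)].

Definition commutative_system (n : nat) (Delta : collection n) : Prop :=
  forall S T : {set 'I_n}, Delta S -> Delta T -> S :&: T <> set0.

Definition maximal_system (n : nat) (Delta : collection n) : Prop :=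
  forall A : {set 'I_n}, odd #|A| -> ~ Delta A ->
    exists2 B, Delta B & A :&: B = set0.

Definition maximal_commutative_algebraic_system (n : nat)
    (Delta : collection n) : Prop :=
  [/\ algebraic_system Delta, commutative_system Delta & maximal_system Delta].

Definition vee1_set (n : nat) (S : {set 'I_n}) : {set {set 'I_n}} :=
  S |: [set S :|: S1 | S1 : {set 'I_n} & (#|S1| == 2) && (S1 :&: S == set0)].

Definition vee1 (n : nat) (B : {set {set 'I_n}}) : {set {set 'I_n}} :=
  \bigcup_(S in B) vee1_set S.

Definition vee (n i : nat) (B : {set {set 'I_n}}) : {set {set 'I_n}} :=
  iter i (@vee1 n) B.

Definition Cone (n : nat) (B : {set {set 'I_n}}) : collection n :=
  fun S => exists2 i, 1 <= i & S \in vee i B.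

(* The seven lines of a Fano plane on {4k+1, ..., 4k+7}; only 1 <= i <= 7 is
   meaningful. *)
Definition L (k i : nat) : {set 'I_(4 * k + 7)} :=
  with_labels (4 * k + 7)
    match i with
    | 1 => [:: 4 * k + 1; 4 * k + 2; 4 * k + 5]
    | 2 => [:: 4 * k + 1; 4 * k + 3; 4 * k + 6]
    | 3 => [:: 4 * k + 1; 4 * k + 4; 4 * k + 7]
    | 4 => [:: 4 * k + 2; 4 * k + 3; 4 * k + 7]
    | 5 => [:: 4 * k + 3; 4 * k + 4; 4 * k + 5]
    | 6 => [:: 4 * k + 5; 4 * k + 6; 4 * k + 7]
    | 7 => [:: 4 * k + 2; 4 * k + 4; 4 * k + 6]
    | _ => [::]
    end.

Definition line_family (k i : nat) : {set {set 'I_(4 * k + 7)}} :=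
  [set L k i :|: S' | S' : {set 'I_(4 * k + 7)}
     & (S' \subset initial_segment (4 * k + 7) (4 * k)) && (#|S'| == 2 * k)].

Definition Cone_2k1 (k : nat) : {set {set 'I_(4 * k + 7)}} :=
  [set S : {set 'I_(4 * k + 7)}
     | (S \subset initial_segment (4 * k + 7) (4 * k)) && (#|S| == 2 * k + 1)].

Definition Cone_2k3 (k : nat) : {set {set 'I_(4 * k + 7)}} :=
  \bigcup_(1 <= i < 8) line_family k i.

(* Main.v *)
Require Import Defs.
From mathcomp Require Import all_boot zify.

(** Write M for [4k] and h = 2k for half its size.  Adjoining pairs of points
to a generator preserves parity and reaches every larger set of the same
parity, so a set lies in the cone exactly when it has odd size and contains a
generator ([ConeP]).  Unfolding the generators, the cone is the collection of
odd sets S that have a strict majority in M, or that have at least half of M and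
contain a line of the Fano plane ([Cone_generatorsE]).  The lines act as a
tie-break, and this gives a maximal commutative system
([tie_break_system_maximal]) because of two properties of the Fano plane:
- any two lines meet ([fano_lines_meet]), so that two sets, each with exactly
  half of M, still meet even if these halves are complementary;
- every set of points or its complement contains a line ([fano_two_colouring]).
  If an odd set A is not in the system, either it has less than half of M, and
  then a majority of M avoids A; or it has exactly half of M and no line, and
  then some line avoids A, and together with the other half of M it is a member
  of the system disjoint from A. *)

Set Implicit Arguments.
Unset Strict Implicit.
Unset Printing Implicit Defensive.

(** * Cones *)

Lemma exists_subset_of_card (T : finType) (A : {set T}) m :
  m <= #|A| -> exists2 B : {set T}, B \subset A & #|B| = m.
Proof.
rewrite -bin_gt0 -cards_draws card_gt0 => /set0Pn[B].
by rewrite inE => /andP[sBA /eqP cardB]; exists B.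
Qed.

(** Removing from S a pair of points outside T lowers m by one, so the
induction peels S down to T. *)
Lemma vee_superset n m (B : {set {set 'I_n}}) (T S : {set 'I_n}) :
  T \in B -> T \subset S -> #|S| = #|T| + m.*2 -> S \in vee m B.
Proof.
move=> TB; elim: m S => [|m IHm] S sTS cardS.
  have /eqP <- : T == S by rewrite eqEcard sTS cardS addn0 leqnn.
  exact: TB.
have cardST : #|S :\: T| = m.+1.*2 by rewrite cardsDS // cardS addKn.
have [|D sDST cardD] := @exists_subset_of_card _ (S :\: T) 2.
  by rewrite cardST doubleS.
have /andP[sDS dDT] : (D \subset S) && [disjoint D & T] by rewrite -subsetD.
apply/bigcupP; exists (S :\: D).
  apply: IHm; first by rewrite subsetD sTS disjoint_sym.
  by rewrite cardsDS // cardD cardS; lia.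
rewrite !inE; apply/orP; right; apply/imsetP; exists D.
  by rewrite inE cardD eqxx setIDA setD_eq0 subsetIl.
by rewrite setUC setDE setUIr setUCr setIT (setUidPr sDS).
Qed.

(** The index i of [vee] is only a bound on the number of adjoined pairs, since
[vee1] also keeps every set; this is why it disappears from the criterion. *)
Lemma ConeP n (B : {set {set 'I_n}}) (S : {set 'I_n}) :
  Cone B S <->
  exists T : {set 'I_n}, [/\ T \in B, T \subset S & odd #|S| = odd #|T|].
Proof.
split=> [[i _] | [T [TB sTS oddST]]].
  elim: i S => [|i IHi] S; first by exists S.
  case/bigcupP=> U /IHi[T [TB sTU oddUT]].
  case/setU1P=> [-> | /imsetP[D]]; first by exists T.
  rewrite inE => /andP[/eqP cardD /eqP DU0] ->; exists T; split=> //.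
    exact: subset_trans sTU (subsetUl U D).
  by rewrite cardsU setIC DU0 cards0 subn0 cardD oddD addbF.
exists (#|S| - #|T|)./2.+1 => //.
apply/bigcupP; exists S; last by rewrite !inE eqxx.
apply: (vee_superset TB sTS).
by have := subset_leq_card sTS; lia.
Qed.

(** * Majority systems with a tie-break *)

Definition tie_break_system n (M : {set 'I_n}) (h : nat) (F : {set {set 'I_n}}) :
    collection n :=
  fun S => odd #|S| /\
    (h < #|S :&: M| \/
     h <= #|S :&: M| /\ exists2 l, l \in F & l \subset S).

Section TieBreak.

Variables (n h : nat) (M : {set 'I_n}) (F : {set {set 'I_n}}).
Hypothesis cardM : #|M| = h.*2.
Hypothesis even_h : ~~ odd h.
Hypothesis odd_line : forall l, l \in F -> odd #|l|.
Hypothesis line_off_M : forall l, l \in F -> [disjoint l & M].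
Hypothesis lines_meet : forall l l', l \in F -> l' \in F -> l :&: l' != set0.
Hypothesis line_in_or_out :
  forall Q : {set 'I_n}, exists2 l, l \in F & (l \subset Q) || (l \subset ~: Q).

Lemma odd_card_line_union (l P : {set 'I_n}) :
  l \in F -> P \subset M -> #|P| = h -> odd #|l :|: P|.
Proof.
move=> lF sPM cardP; rewrite cardsU.
have /eqP-> : l :&: P == set0.
  by rewrite setI_eq0 (disjointWr sPM) ?line_off_M.
by rewrite cards0 subn0 cardP oddD odd_line // (negbTE even_h).
Qed.

Lemma line_union_mem (l P : {set 'I_n}) :
  l \in F -> P \subset M -> #|P| = h -> tie_break_system M h F (l :|: P).
Proof.
move=> lF sPM cardP; split; first exact: odd_card_line_union.
right; split; last by exists l => //; exact: subsetUl.
by rewrite -cardP subset_leq_card // subsetI subsetUr.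
Qed.

Lemma majority_mem (P : {set 'I_n}) :
  P \subset M -> #|P| = h.+1 -> tie_break_system M h F P.
Proof.
move=> sPM cardP; split; first by rewrite cardP.
by left; rewrite (setIidPl sPM) cardP.
Qed.

(** A member shrinks to a generator inside it by dropping points of M beyond
the required h.+1 or h, and points off M beyond the line.  The parity condition
of [ConeP] is then automatic: both kinds of generators have odd size because h
is even. *)
Lemma Cone_generatorsE (S : {set 'I_n}) :
  Cone ([set P : {set 'I_n} | (P \subset M) && (#|P| == h.+1)] :|:
        [set l :|: P | l in F, P in [set P : {set 'I_n}
                                    | (P \subset M) && (#|P| == h)]]) S <->
  tie_break_system M h F S.
Proof.
split=> [/ConeP[T [TB sTS oddST]] | [oddS majS]].
  have leM : #|T :&: M| <= #|S :&: M| by rewrite subset_leq_card ?setSI.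
  have [oddT majT] : tie_break_system M h F T; last first.
    split; first by rewrite oddST.
    case: majT => [ltT | [leT [l lF slT]]]; first by left; exact: leq_trans leM.
    right; split; first exact: leq_trans leM.
    by exists l => //; exact: subset_trans sTS.
  move: TB; rewrite inE => /orP[|/imset2P[l P lF]].
    by rewrite inE => /andP[sTM /eqP]; exact: majority_mem.
  by rewrite inE => /andP[sPM /eqP cardP] ->; exact: line_union_mem.
apply/ConeP; case: majS => [/exists_subset_of_card[P] | [/exists_subset_of_card[P]]].
  rewrite subsetI => /andP[sPS sPM] cardP; exists P; split=> //.
    by rewrite !inE sPM cardP eqxx.
  by rewrite oddS cardP /= even_h.
rewrite subsetI => /andP[sPS sPM] cardP [l lF slS]; exists (l :|: P); split.
- apply/setUP; right; apply/imset2P; exists l P => //.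
  by rewrite inE sPM cardP eqxx.
- by rewrite subUset slS.
- by rewrite oddS odd_card_line_union.
Qed.

Lemma tie_break_algebraic : algebraic_system (tie_break_system M h F).
Proof.
split=> [|S [] //|A1 A2 evenA1 [oddA2 majA2] A12].
  have [l lF _] := line_in_or_out set0.
  have [|P sPM cardP] := @exists_subset_of_card _ M h.
    by rewrite cardM -addnn leq_addr.
  by exists (l :|: P); exact: line_union_mem.
split; first by rewrite cardsU A12 cards0 subn0 oddD (negbTE evenA1).
have leM : #|A2 :&: M| <= #|(A1 :|: A2) :&: M|.
  by rewrite subset_leq_card ?setSI ?subsetUr.
case: majA2 => [ltA2 | [leA2 [l lF slA2]]]; first by left; exact: leq_trans leM.
right; split; first exact: leq_trans leM.
by exists l => //; exact: subset_trans (subsetUr A1 A2).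
Qed.

(** Two disjoint members could only have exactly h points of M each, and then
both contain a line. *)
Lemma tie_break_commutative : commutative_system (tie_break_system M h F).
Proof.
move=> S T [_ majS] [_ majT] ST0.
have sumST : #|S :&: M| + #|T :&: M| <= h.*2.
  rewrite -cardM -cardsUI setIACA ST0 set0I cards0 addn0.
  by rewrite subset_leq_card // subUset !subsetIr.
case: majS majT => [ltS|[leS [l lF slS]]] [ltT|[leT [l' l'F sl'T]]]; try lia.
by have := lines_meet lF l'F; rewrite -subset0 -ST0 setISS.
Qed.

Lemma tie_break_maximal : maximal_system (tie_break_system M h F).
Proof.
move=> A oddA notA.
have splitM : #|M :&: A| + #|M :\: A| = h.*2 by rewrite cardsID.
have offA (B : {set 'I_n}) : B \subset ~: A -> A :&: B = set0.
  by rewrite -disjoints_subset => dBA; apply: disjoint_setI0; rewrite disjoint_sym.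
have sMA : M :\: A \subset ~: A by rewrite setDE subsetIr.
case: (ltngtP #|A :&: M| h) => [ltA | gtA | eqA].
- have [|P sPMA cardP] := @exists_subset_of_card _ (M :\: A) h.+1.
    by move: ltA; rewrite setIC; lia.
  exists P; last exact/offA/(subset_trans sPMA).
  by apply: majority_mem => //; apply: subset_trans sPMA (subsetDl _ _).
- by case: notA; split=> //; left.
- have [l lF /orP[slA | slA]] := line_in_or_out A.
    by case: notA; split=> //; right; split; [rewrite eqA | exists l].
  exists (l :|: (M :\: A)); last by apply: offA; rewrite subUset slA.
  apply: line_union_mem => //; first exact: subsetDl.
  by move: eqA; rewrite setIC; lia.
Qed.

Theorem tie_break_system_maximal :
  maximal_commutative_algebraic_system (tie_break_system M h F).
Proof.
split; [exact: tie_break_algebraic | exact: tie_break_commutative |].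
exact: tie_break_maximal.
Qed.

End TieBreak.

(** * The Fano plane *)

Definition fano (i : nat) : seq nat :=
  match i with
  | 1 => [:: 1; 2; 5]
  | 2 => [:: 1; 3; 6]
  | 3 => [:: 1; 4; 7]
  | 4 => [:: 2; 3; 7]
  | 5 => [:: 3; 4; 5]
  | 6 => [:: 5; 6; 7]
  | 7 => [:: 2; 4; 6]
  | _ => [::]
  end.

Lemma fano_points (i : 'I_7) :
  [/\ uniq (fano i.+1), size (fano i.+1) = 3 &
      all (fun p => 0 < p <= 7) (fano i.+1)].
Proof. by case: i => [] [|[|[|[|[|[|[|]]]]]]]. Qed.

Lemma fano_lines_meet (i j : 'I_7) :
  exists2 p, p \in fano i.+1 & p \in fano j.+1.
Proof.
apply/hasP.
by case: i j => [] [|[|[|[|[|[|[|]]]]]]] //= ? [] [|[|[|[|[|[|[|]]]]]]].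
Qed.

Lemma fano_two_colouring (q : pred nat) :
  exists i : 'I_7, all q (fano i.+1) || all (predC q) (fano i.+1).
Proof.
suff /hasP[i] : has (fun i => all q (fano i.+1) || all (predC q) (fano i.+1))
                    (iota 0 7).
  by rewrite mem_iota => lti monoi; exists (Ordinal lti).
rewrite /=.
by case: (q 1); case: (q 2); case: (q 3); case: (q 4); case: (q 5);
  case: (q 6); case: (q 7).
Qed.

Section FanoLines.

Variable k : nat.
Local Notation n := (4 * k + 7).

Definition fano_lines : {set {set 'I_n}} := [set L k i.+1 | i : 'I_7].

(* The value of an ordinal is one less than its label, hence the predecessor;
   the minimum makes the map total, and is p for the seven points. *)
Lemma fano_point_subproof p : (4 * k + minn p 7).-1 < n.
Proof. by rewrite /minn; case: ifP => ?; lia. Qed.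

Definition fano_point p : 'I_n := Ordinal (fano_point_subproof p).

Lemma mem_L (i : 'I_7) (x : 'I_n) :
  (x \in L k i.+1) = (x.+1 \in map (addn (4 * k)) (fano i.+1)).
Proof. by rewrite inE; case: i => [] [|[|[|[|[|[|[|]]]]]]]. Qed.

Lemma L_fano (i : 'I_7) : L k i.+1 = [set:: map fano_point (fano i.+1)].
Proof.
have [_ _ /allP bnd] := fano_points i.
apply/setP=> x; rewrite mem_L inE; apply/mapP/mapP=> [] [p pi].
  move=> xp; exists p => //; apply: val_inj => /=.
  by move: (bnd p pi) xp; rewrite /minn; case: ifP; lia.
move=> ->; exists p => //=.
by move: (bnd p pi); rewrite /minn; case: ifP; lia.
Qed.

Lemma card_fano_line l : l \in fano_lines -> #|l| = 3.
Proof.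
case/imsetP=> i _ ->; have [uniq_i size_i /allP bnd] := fano_points i.
rewrite L_fano cardsE (card_uniqP _) ?size_map //.
rewrite map_inj_in_uniq // => p q /bnd bp /bnd bq /(congr1 val) /=.
by rewrite /minn; case: ifP; case: ifP; lia.
Qed.

Lemma fano_line_disjoint l :
  l \in fano_lines -> [disjoint l & initial_segment n (4 * k)].
Proof.
case/imsetP=> i _ ->; have [_ _ /allP bnd] := fano_points i.
rewrite disjoints_subset; apply/subsetP=> x.
by rewrite mem_L => /mapP[p /bnd bp xp]; rewrite !inE xp; lia.
Qed.

Lemma fano_lines_intersect l l' :
  l \in fano_lines -> l' \in fano_lines -> l :&: l' != set0.
Proof.
move=> /imsetP[i _ ->] /imsetP[j _ ->]; have [p pi pj] := fano_lines_meet i j.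
by apply/set0Pn; exists (fano_point p); rewrite !L_fano !inE !map_f.
Qed.

Lemma fano_line_in_or_out (Q : {set 'I_n}) :
  exists2 l, l \in fano_lines & (l \subset Q) || (l \subset ~: Q).
Proof.
have [i mono_i] := fano_two_colouring [pred p | fano_point p \in Q].
exists (L k i.+1); first exact: imset_f.
case/orP: mono_i => /allP mono_i; apply/orP; [left | right];
  by apply/subsetP=> x; rewrite L_fano inE => /mapP[p /mono_i /= Qp ->] //; rewrite inE.
Qed.

Lemma card_initial_segment : #|initial_segment n (4 * k)| = (2 * k).*2.
Proof.
have le4k : 4 * k <= n by rewrite leq_addr.
have -> : initial_segment n (4 * k) = widen_ord le4k @: [set: 'I_(4 * k)].
  apply/setP=> x; rewrite inE; apply/idP/imsetP=> [ltx | [y _ ->]].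
    by exists (Ordinal ltx) => //; apply: val_inj.
  exact: ltn_ord y.
rewrite card_imset; first by rewrite cardsT card_ord; lia.
by move=> x y /(congr1 val) /= /val_inj.
Qed.

Lemma Cone_generators_fano :
  Cone_2k1 k :|: Cone_2k3 k =
  [set P : {set 'I_n} |
     (P \subset initial_segment n (4 * k)) && (#|P| == (2 * k).+1)] :|:
  [set l :|: P | l in fano_lines, P in [set P : {set 'I_n} |
     (P \subset initial_segment n (4 * k)) && (#|P| == 2 * k)]].
Proof.
congr (_ :|: _); first by apply/setP=> S; rewrite !inE addn1.
rewrite /Cone_2k3 big_add1 big_mkord.
apply/setP=> S; apply/bigcupP/imset2P=> [[i _ /imsetP[P PM ->]] | [l P]].
  by exists (L k i.+1) P => //; exact: imset_f.
by case/imsetP=> i _ -> PM ->; exists i => //; apply/imsetP; exists P.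
Qed.

End FanoLines.

(** * The cone of the theorem *)

Lemma eq_maximal_system n (D E : collection n) :
  (forall S, D S <-> E S) ->
  maximal_commutative_algebraic_system E ->
  maximal_commutative_algebraic_system D.
Proof.
move=> DE [[[S0 ES0] oddE unionE] commE maxE]; split.
- split; first by exists S0; apply/DE.
    by move=> S /DE/oddE.
  by move=> A1 A2 evenA1 /DE EA2 A12; apply/DE/unionE.
- by move=> S T /DE ES /DE ET; exact: commE.
- move=> A oddA notDA; have [/DE EA //|B EB AB] := maxE A oddA.
  by exists B => //; apply/DE.
Qed.

Theorem theorem3 (k : nat) (hk : 2 <= k) :
  (forall S : {set 'I_(4 * k + 7)},
      Cone (Cone_2k1 k :|: Cone_2k3 k) S -> P_star S) /\
  maximal_commutative_algebraic_system (Cone (Cone_2k1 k :|: Cone_2k3 k)).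
Proof.
have even_h : ~~ odd (2 * k) by rewrite oddM.
have odd_line l : l \in fano_lines k -> odd #|l| by move/card_fano_line->.
have ConeE S : Cone (Cone_2k1 k :|: Cone_2k3 k) S <->
    tie_break_system (initial_segment _ (4 * k)) (2 * k) (fano_lines k) S.
  rewrite Cone_generators_fano.
  exact: Cone_generatorsE even_h odd_line (@fano_line_disjoint k) S.
split=> [S /ConeE[oddS _] |].
  by apply: contraTneq oddS => ->; rewrite cards0.
apply: eq_maximal_system ConeE _; apply: tie_break_system_maximal => //.
- exact: card_initial_segment.
- exact: fano_line_disjoint.
- exact: fano_lines_intersect.
- exact: fano_line_in_or_out.
Qed.
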